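(* Let $S$ be a semigroup such that for every finite coloring of $S$ there is a monochromatic proper IP set. Then for every finite coloring of $S$ there are infinitely many pairwise disjoint monochromatic proper IP sets (hence, since there are finitely many colors, infinitely many pairwise disjoint proper IP sets all of the same color).
   Context: Semigroups are written additively and are not assumed commutative. For a sequence $a_1,a_2,\dotsc$, $\mathrm{FS}(a_1,a_2,\dotsc):=\{a_{i_1}+\dotsb+a_{i_m}: m\ge1,\ i_1<\dotsb<i_m\}$. A proper IP set is a set containing $\mathrm{FS}(b_1,b_2,\dotsc)$ for some injective sequence $b_1,b_2,\dotsc$. A finite coloring of $S$ is a map from $S$ to a finite set; a subset is monochromatic if the coloring is constant on it. *)

(* Defs.v *)
From mathcomp Require Import all_boot.
Set Implicit Arguments. Unset Strict Implicit. Unset Printing Implicit Defensive.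

Definition associative_op (S : Type) (op : S -> S -> S) : Prop :=
  forall x y z, op x (op y z) = op (op x y) z.

(* Finite sums a_{i_1} + ... + a_{i_m}, m >= 1, i_1 < ... < i_m, summed in
   increasing index order: the index list is (i :: s), strictly increasing. *)
Definition FS (S : Type) (op : S -> S -> S) (a : nat -> S) : S -> Prop :=
  fun x => exists (i : nat) (s : seq nat),
    sorted ltn (i :: s) /\ x = foldl (fun acc j => op acc (a j)) (a i) s.

Definition proper_IP (S : Type) (op : S -> S -> S) (A : S -> Prop) : Prop :=
  exists b : nat -> S, injective b /\ (forall x, FS op b x -> A x).

Definition monochromatic (S C : Type) (c : S -> C) (A : S -> Prop) : Prop :=
  exists col : C, forall x, A x -> c x = col.

(* Main.v *)
(** Call P large if every finite coloring admits a monochromatic proper IP set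
    inside P; largeness passes to one of the two cells of any partition of P.
    Starting from a large color class, repeatedly remove a non-large proper IP
    subset. If this never stops, the removed sets are the desired family.
    Otherwise some large A has only large proper IP subsets, and it suffices to
    find a sequence in A such that finite sums over disjoint index sets differ.

    - If every proper IP set B in A contains some u such that u + x = u for all
      x in a proper IP subset of B, iterating yields distinct e_0, e_1, ... with
      e_i + e_j = e_i for i < j, so a finite sum of them determines its first
      index.
    - Otherwise fix B without such a u. For e, v in B the equation e + x = v
      cannot hold on an IP set FS(b) (else v + y = e + b_0 + y = v for every y
      in FS(b_1, b_2, ...)). By largeness one can then choose each new term so
      that no sum involving it equals an earlier sum, and a finite sum
      determines its last index. *)
Require Import Defs.
From mathcomp Require Import all_boot.
From Stdlib Require Import Classical ClassicalEpsilon.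
Set Implicit Arguments. Unset Strict Implicit. Unset Printing Implicit Defensive.

(** The choice is iterated on the subtype of states satisfying [I], so the invariant travels with
    the state. Each infinite construction below runs through this. *)
Lemma dependent_choice (X : Type) (I : X -> Prop) (R : X -> X -> Prop) :
  (forall x, I x -> exists y, I y /\ R x y) ->
  forall x0, I x0 ->
  exists s : nat -> X, s 0 = x0 /\ forall n, I (s n) /\ R (s n) (s n.+1).
Proof.
move=> step x0 Ix0.
pose next (p : {x | I x}) : {x | I x} :=
  let w := constructive_indefinite_description _ (step _ (proj2_sig p)) in
  exist I (proj1_sig w) (proj1 (proj2_sig w)).
exists (fun n => proj1_sig (iter n next (exist I x0 Ix0))); split=> // n.
split; first exact: proj2_sig.
rewrite iterS; set p := iter n _ _.
by rewrite /next /=; case: (constructive_indefinite_description _ _) => y [].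
Qed.

(** * Finite sums and disjoint families of proper IP sets *)

Section ProperIP.

Variables (S : Type) (op : S -> S -> S).

Definition fsum (b : nat -> S) (i : nat) (s : seq nat) : S :=
  foldl (fun acc j => op acc (b j)) (b i) s.

Definition disjoint_IPs (A : S -> Prop) : Prop :=
  exists F : nat -> S -> Prop,
    (forall n m, n <> m -> forall x, F n x -> F m x -> False) /\
    (forall n, proper_IP op (F n) /\ forall x, F n x -> A x).

(** Contrapositively, sums over disjoint index sets differ. A sum determining its first index and a
    sum determining its last index both imply this. *)
Definition index_meeting (b : nat -> S) : Prop :=
  forall i s j t, sorted ltn (i :: s) -> sorted ltn (j :: t) ->
    fsum b i s = fsum b j t -> exists2 k, k \in i :: s & k \in j :: t.

Lemma FS_fsum (b : nat -> S) x :
  FS op b x -> exists i s, sorted ltn (i :: s) /\ x = fsum b i s.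
Proof. by []. Qed.

Lemma FS_term (b : nat -> S) (n : nat) : FS op b (b n).
Proof. by exists n, [::]. Qed.

Lemma fsum_comp (b : nat -> S) (f : nat -> nat) i s :
  fsum (b \o f) i s = fsum b (f i) (map f s).
Proof.
rewrite /fsum /=; elim: s (b (f i)) => //= j s IH a; exact: IH.
Qed.

Lemma sorted_map_mono (f : nat -> nat) s :
  {homo f : m n / m < n} -> sorted ltn s -> sorted ltn (map f s).
Proof. by move=> fmono; rewrite sorted_map; apply: sub_sorted => m n /fmono. Qed.

Lemma FS_comp (b : nat -> S) (f : nat -> nat) x :
  {homo f : m n / m < n} -> FS op (b \o f) x -> FS op b x.
Proof.
move=> fmono [i [s [ss ->]]]; exists (f i), (map f s).
by split; [exact: (sorted_map_mono (s := i :: s)) | exact: fsum_comp].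
Qed.

Lemma proper_IP_FS (b : nat -> S) : injective b -> proper_IP op (FS op b).
Proof. by move=> binj; exists b. Qed.

Lemma proper_IP_sub (A B : S -> Prop) :
  (forall x, A x -> B x) -> proper_IP op A -> proper_IP op B.
Proof. by move=> AB [b [binj bA]]; exists b; split=> // x /bA/AB. Qed.

Lemma proper_IP_not_single (A : S -> Prop) (u : S) :
  (forall x, A x -> x = u) -> ~ proper_IP op A.
Proof.
move=> Au [b [binj bA]].
have /binj // : b 0 = b 1.
by rewrite (Au _ (bA _ (FS_term b 0))) (Au _ (bA _ (FS_term b 1))).
Qed.

Lemma disjoint_IPs_sub (A B : S -> Prop) :
  (forall x, A x -> B x) -> disjoint_IPs A -> disjoint_IPs B.
Proof.
move=> AB [F [Fd FA]]; exists F; split=> // n.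
by have [FI Fn] := FA n; split=> // x /Fn/AB.
Qed.

(** Split the indices into infinitely many infinite disjoint classes; the subsequences along them
    have disjoint sets of finite sums. *)
Lemma disjoint_IPs_meeting (b : nat -> S) :
  index_meeting b -> disjoint_IPs (FS op b).
Proof.
(* [f n] enumerates the integers of 2-adic valuation [n], which [logf] recovers. *)
move=> bmeet; pose f n m := 2 ^ n * m.*2.+1.
have fmono n : {homo f n : m p / m < p}.
  by move=> m p mp; rewrite /f ltn_pmul2l ?expn_gt0 // ltnS ltn_double.
have logf n m : logn 2 (f n m) = n.
  rewrite /f lognM ?expn_gt0 // pfactorK // lognE dvdn2 /= odd_double /=.
  by rewrite addn0.
have binj : injective b.
  move=> i j bij; have [k] := bmeet i [::] j [::] isT isT bij.
  by rewrite !inE => /eqP -> /eqP.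
exists (fun n => FS op (b \o f n)); split=> [n m nm x|n]; last first.
  split; last by move=> x; apply: FS_comp.
  apply: proper_IP_FS => i j /binj /eqP; rewrite eqn_pmul2l ?expn_gt0 //.
  by rewrite eqSS => /eqP/double_inj.
move=> /FS_fsum [i [s [ss ->]]] /FS_fsum [j [t [tt]]].
rewrite (fsum_comp b (f n)) (fsum_comp b (f m)) => E.
have [k] := bmeet _ _ _ _ (sorted_map_mono (fmono n) ss)
  (sorted_map_mono (fmono m) tt) E.
move=> /(mapP (s := i :: s)) [p _ ->] /(mapP (s := j :: t)) [q _ pq].
by apply: nm; rewrite -(logf n p) pq logf.
Qed.

(** * Largeness and its partition regularity *)

Definition large (P : S -> Prop) : Prop :=
  forall (k : nat) (c : S -> 'I_k), exists A : S -> Prop,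
    [/\ proper_IP op A, forall x, A x -> P x & monochromatic c A].

Lemma large_proper_IP (P : S -> Prop) : large P -> proper_IP op P.
Proof.
by move=> /(_ 1 (fun=> ord0)) [A [AI AP _]]; apply: proper_IP_sub AI.
Qed.

Lemma large_sub (P Q : S -> Prop) :
  (forall x, P x -> Q x) -> large P -> large Q.
Proof.
move=> PQ lP k c; have [A [AI AP Am]] := lP k c.
by exists A; split=> // x /AP/PQ.
Qed.

(** Bad colorings [c1], [c2] of the two cells glue to one with [k1 + k2] colors. The block
    containing the color of a monochromatic set tells which cell contains the set, contradicting
    [c1] or [c2]. *)
Lemma large_split (P Q : S -> Prop) : large P ->
  large (fun x => P x /\ Q x) \/ large (fun x => P x /\ ~ Q x).
Proof.
move=> lP; apply: NNPP => /not_or_and [nQ nN]; apply: nQ => k1 c1.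
apply: NNPP => bad1; apply: nN => k2 c2.
pose c x := if excluded_middle_informative (Q x) then lshift k2 (c1 x)
            else rshift k1 (c2 x).
have cQ x : Q x -> c x = lshift k2 (c1 x).
  by rewrite /c; case: (excluded_middle_informative _).
have cN x : ~ Q x -> c x = rshift k1 (c2 x).
  by rewrite /c; case: (excluded_middle_informative _).
have [A [AI AP [col Acol]]] := lP _ c.
case: (split_ordP col) => [i|i] coli.
- have AQ x : A x -> Q x.
    move=> /Acol cx; apply: NNPP => /cN; rewrite cx coli => /eqP.
    by rewrite eq_lrshift.
  case: bad1; exists A; split=> //; first by move=> x Ax; split; auto.
  exists i => x Ax; apply: (@lshift_inj k1 k2).
  by rewrite -cQ ?Acol //; apply: AQ.
- have AN x : A x -> ~ Q x.
    by move=> /Acol cx /cQ; rewrite cx coli => /eqP; rewrite eq_rlshift.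
  exists A; split=> //; first by move=> x Ax; split; auto.
  exists i => x Ax; apply: (@rshift_inj k1 k2).
  by rewrite -cN ?Acol //; apply: AN.
Qed.

(** Pieces are removed one by one: a piece without a proper IP subset is not large, so its
    complement is. [List.In] is used because the types carry no decidable equality. *)
Lemma large_avoid (I : Type) (s : list I) (Q : I -> S -> Prop) (P : S -> Prop) :
  large P ->
  (forall i, List.In i s -> ~ proper_IP op (fun x => P x /\ Q i x)) ->
  large (fun x => P x /\ forall i, List.In i s -> ~ Q i x).
Proof.
elim: s => [|i s IH] lP sQ; first by apply: large_sub lP => x Px; split.
have lPs := IH lP (fun j js => sQ j (or_intror js)).
case: (large_split (Q i) lPs) => [/large_proper_IP lQ|].
  by case: (sQ i); [left | apply: proper_IP_sub lQ => x [[]]].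
by apply: large_sub => x [[Px sx] ix]; split=> // j [<- //|/sx].
Qed.

Lemma large_color (k : nat) (c : S -> 'I_k) (P : S -> Prop) :
  large P -> exists col, large (fun x => P x /\ c x = col).
Proof.
(* Induction on a list of colors that can still occur on [P]; it cannot run out, as a large set is
   inhabited. *)
move=> lP; have [s Ps] : exists s : seq 'I_k, forall x, P x -> c x \in s.
  by exists (enum 'I_k) => x _; rewrite mem_enum.
elim: s P lP Ps => [|i s IH] P lP Ps.
  have [b [_ bP]] := large_proper_IP lP.
  by have := Ps _ (bP _ (FS_term b 0)).
case: (large_split (fun x => c x = i) lP) => [|lN]; first by exists i.
have [|col lcol] := IH _ lN.
  by move=> x [/Ps]; rewrite inE => /orP [/eqP|].
by exists col; apply: large_sub lcol => x [[]].
Qed.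

(** * Removing non-large proper IP sets *)

Definition hereditarily_large (A : S -> Prop) : Prop :=
  forall B : S -> Prop, proper_IP op B -> (forall x, B x -> A x) -> large B.

Lemma hereditarily_large_sub (A B : S -> Prop) :
  (forall x, A x -> B x) -> hereditarily_large B -> hereditarily_large A.
Proof. by move=> AB hB C CI CA; apply: hB => // x /CA/AB. Qed.

Lemma disjoint_IPs_or_hereditarily_large (A : S -> Prop) : large A ->
  disjoint_IPs A \/
  exists B, [/\ large B, forall x, B x -> A x & hereditarily_large B].
Proof.
move=> lA; case: (classic (exists B, [/\ large B, forall x, B x -> A x
  & hereditarily_large B])) => [|noB]; [by right | left].
pose I (P : S -> Prop) := large P /\ forall x, P x -> A x.
(* Successive differences of the decreasing chain will form the disjoint family. *)
pose R (P Q : S -> Prop) := (forall x, Q x -> P x) /\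
  proper_IP op (fun x => P x /\ ~ Q x).
have step P : I P -> exists Q, I Q /\ R P Q.
  move=> [lP PA]; apply: NNPP => noQ; apply: noB; exists P; split=> // B BI BP.
  apply: NNPP => nB; apply: noQ; exists (fun x => P x /\ ~ B x).
  case: (large_split B lP) => [/large_sub lB|lPB].
    by case: nB; apply: lB => x [].
  split; first by split=> // x [/PA].
  split=> [x []//|]; apply: proper_IP_sub BI => x Bx.
  by split; [exact: BP | case].
have [|P [P0 PIR]] := dependent_choice step (x0 := A); first by split.
have Pmono n m : n <= m -> forall x, P m x -> P n x.
  elim: m => [|m IH]; first by rewrite leqn0 => /eqP ->.
  rewrite leq_eqVlt => /orP [/eqP -> //|/IH nm x].
  by have [_ [sub _]] := PIR m; move=> /sub/nm.
exists (fun n x => P n x /\ ~ P n.+1 x); split=> [|n]; last first.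
  by have [[_ PA] [_ PI]] := PIR n; split=> // x [/PA].
have lt n m x : n < m -> P m x -> ~ P n.+1 x -> False.
  by move=> nm /(Pmono _ _ nm).
move=> n m nm x [Pn nPn] [Pm nPm]; case: (ltngtP n m) => // [/lt|/lt]; eauto.
Qed.

(** * The case where sums collapse to their first term *)

Lemma index_meeting_min (e : nat -> S) :
  (forall i j, i < j -> op (e i) (e j) = e i) -> injective e ->
  index_meeting e /\ forall x, FS op e x -> exists i, x = e i.
Proof.
move=> eL einj.
have fsumE i s : sorted ltn (i :: s) -> fsum e i s = e i.
  rewrite /fsum /= (path_sortedE ltn_trans) => /andP [+ _].
  by elim: s => //= j s IH /andP [/eL -> /IH].
split=> [i s j t ss tt|x [i [s [ss ->]]]].
  by rewrite !fsumE // => /einj ->; exists j; rewrite mem_head.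
by exists i; apply: fsumE.
Qed.

Lemma disjoint_IPs_of_fixed_left (A : S -> Prop) :
  proper_IP op A -> hereditarily_large A ->
  (forall B : S -> Prop, proper_IP op B -> (forall x, B x -> A x) ->
     exists u, B u /\ proper_IP op (fun x => B x /\ op u x = u)) ->
  disjoint_IPs A.
Proof.
move=> AI hA fix_u.
pose I (p : S * (S -> Prop)) :=
  proper_IP op p.2 /\ forall x, p.2 x -> A x.
(* A state pairs the latest term with the set from which all later terms are drawn. *)
pose R (p q : S * (S -> Prop)) := p.2 q.1 /\
  forall x, q.2 x -> [/\ p.2 x, op q.1 x = q.1 & x <> q.1].
have step p : I p -> exists q, I q /\ R p q.
  move=> [pI pA]; have [u [pu uI]] := fix_u _ pI pA.
  (* Largeness allows [u] itself to be deleted while keeping a proper IP set, so that the terms are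
     distinct. *)
  have lu : large (fun x => p.2 x /\ op u x = u) by apply: hA => // x [/pA].
  have small v : List.In v [:: u] ->
      ~ proper_IP op (fun x => (p.2 x /\ op u x = u) /\ x = v).
    by move=> _; apply: (proper_IP_not_single (u := v)) => x [].
  have lv := large_avoid (Q := fun v x => x = v) lu small.
  exists (u, fun x => [/\ p.2 x, op u x = u & x <> u]); split; last by split.
  split; last by move=> x [/pA].
  by apply: proper_IP_sub (large_proper_IP lv) => x [[px ux] /(_ u (or_introl erefl))].
have [b [binj bA]] := AI.
(* Here [b 0] is a placeholder: the sequence [e] is read from index 1 on. *)
have [|q [q0 qIR]] := dependent_choice step (x0 := (b 0, A)).
  by split=> //; exists b.
have qmono n m : n <= m -> forall x, (q m).2 x -> (q n).2 x.
  elim: m => [|m IH]; first by rewrite leqn0 => /eqP ->.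
  rewrite leq_eqVlt => /orP [/eqP -> //|/IH nm x].
  by have [_ [_ sub]] := qIR m; move=> /sub [/nm].
pose e n := (q n.+1).1.
have eq2 n : (q n).2 (e n) by have [_ []] := qIR n.
have elt i j : i < j -> op (e i) (e j) = e i /\ e j <> e i.
  move=> ij; have [_ [_ /(_ (e j))]] := qIR i.
  by case; first exact: qmono ij _ (eq2 j).
have einj : injective e.
  move=> i j eij; case: (ltngtP i j) => // /elt [_]; first by move/esym: eij.
  by rewrite eij.
have [emeet eFS] := index_meeting_min (fun i j ij => proj1 (elt i j ij)) einj.
apply: disjoint_IPs_sub (disjoint_IPs_meeting emeet) => x /eFS [i ->].
by have [[_ sub] _] := qIR i; apply: sub.
Qed.

(** * The case where each new term creates only new sums *)

Hypothesis opA : associative_op op.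

(** Sums are nested to the left, so prepending a term takes associativity. *)
Lemma FS_cons (b : nat -> S) (y : S) :
  FS op (b \o succn) y -> FS op b (op (b 0) y).
Proof.
move=> /FS_fsum [i [s [ss ->]]]; exists 0, (map succn (i :: s)); split.
  exact: (sorted_map_mono (f := succn) (s := i :: s)).
rewrite (fsum_comp b succn) /fsum /=.
by elim: (map succn s) (b i.+1) => //= j t IH a; rewrite IH opA.
Qed.

Lemma translate_not_proper_IP (B : S -> Prop) (e v : S) :
  ~ proper_IP op (fun x => B x /\ op v x = v) ->
  ~ proper_IP op (fun x => B x /\ op e x = v).
Proof.
move=> nv [b [binj bv]]; apply: nv; exists (b \o succn); split.
  by apply: inj_comp => //; apply: succn_inj.
move=> x xb; have [_ b0] := bv _ (FS_term b 0).
have [_ bx] := bv _ (FS_cons xb).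
split; first by have [] := bv x (FS_comp (f := succn) (fun _ _ => id) xb).
by rewrite -{1}b0 -opA.
Qed.

(** [Z n] contains every sum of terms of index below [n]. A sum with last index [n] enters at
    [Z n.+1] and is absent from [Z n], hence determines [n]. *)
Lemma index_meeting_max (z : nat -> S) (Z : nat -> list S) :
  (forall n, Z n.+1 = (Z n ++ z n :: List.map (op^~ (z n)) (Z n))%list) ->
  (forall n, ~ List.In (z n) (Z n)) ->
  (forall n e, List.In e (Z n) -> ~ List.In (op e (z n)) (Z n)) ->
  index_meeting z /\ forall x, FS op z x -> exists n, List.In x (Z n).
Proof.
move=> ZS zZ ezZ.
have Zmono n m : n <= m -> forall x, List.In x (Z n) -> List.In x (Z m).
  elim: m => [|m IH]; first by rewrite leqn0 => /eqP ->.
  rewrite leq_eqVlt => /orP [/eqP -> //|/IH nm x /nm xm].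
  by rewrite ZS; apply/List.in_app_iff; left.
have sumZ i s : sorted ltn (i :: s) ->
    List.In (fsum z i s) (Z (last i s).+1) /\
    ~ List.In (fsum z i s) (Z (last i s)).
  rewrite /fsum; elim/last_ind: s => [_|s j IH].
    by split=> //=; rewrite ZS; apply/List.in_app_iff; right; left.
  rewrite /= rcons_path foldl_rcons last_rcons => /andP [/IH [sZ _] ltj].
  have {}sZ := Zmono _ _ ltj _ sZ; split; last exact: ezZ.
  rewrite ZS; apply/List.in_app_iff; right; right.
  by apply: (List.in_map (op^~ (z j))).
have lt i s j t : sorted ltn (i :: s) -> sorted ltn (j :: t) ->
    last i s < last j t -> fsum z i s <> fsum z j t.
  move=> /sumZ [sZ _] /sumZ [_ tZ] st E; apply: tZ; rewrite -E.
  exact: Zmono st _ sZ.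
split=> [i s j t ss tt E|x [i [s [ss ->]]]]; last first.
  by exists (last i s).+1; have [] := sumZ i s ss.
exists (last i s); first exact: mem_last.
case: (ltngtP (last i s) (last j t)) => [/(lt _ _ _ _ ss tt)//|
  /(lt _ _ _ _ tt ss) /(_ (esym E))//|->]; exact: mem_last.
Qed.

Lemma disjoint_IPs_of_no_fixed_left (B : S -> Prop) :
  proper_IP op B -> hereditarily_large B ->
  (forall u, B u -> ~ proper_IP op (fun x => B x /\ op u x = u)) ->
  disjoint_IPs B.
Proof.
move=> BI hB nofix.
(* A state holds the latest term, the list of sums so far, and the reservoir of later terms. The
   last clause keeps future sums in [B], where [nofix] applies. *)
pose I (p : S * list S * (S -> Prop)) :=
  [/\ proper_IP op p.2, forall x, p.2 x -> B x,
      forall e, List.In e p.1.2 -> B e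
    & forall e, List.In e p.1.2 -> forall y, p.2 y -> B (op e y)].
pose R (p q : S * list S * (S -> Prop)) :=
  [/\ q.1.2 = (p.1.2 ++ q.1.1 :: List.map (op^~ q.1.1) p.1.2)%list,
      ~ List.In q.1.1 p.1.2
    & forall e, List.In e p.1.2 -> ~ List.In (op e q.1.1) p.1.2].
have step p : I p -> exists q, I q /\ R p q.
  case: p => [[x0 Z] T] [/= TI TB ZB ZTB].
  have lT : large T by apply: hB.
  have small v : List.In v Z -> ~ proper_IP op (fun x => T x /\ x = v).
    by move=> _; apply: (proper_IP_not_single (u := v)) => x [].
  have lT1 := large_avoid (Q := fun v x => x = v) lT small.
  (* Each pair (e, v) of earlier sums gives an equation e + x = v that the new term must avoid. *)
  have small2 ev : List.In ev (List.list_prod Z Z) ->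
      ~ proper_IP op (fun x =>
          (T x /\ forall v, List.In v Z -> x <> v) /\ op ev.1 x = ev.2).
    case: ev => e v /List.in_prod_iff [eZ vZ] evI.
    apply: (translate_not_proper_IP (e := e) (nofix v (ZB v vZ))).
    by apply: proper_IP_sub evI => x [[/TB]].
  have [b [binj bT]] := large_proper_IP
    (large_avoid (Q := fun ev x => op ev.1 x = ev.2) lT1 small2).
  pose T' := FS op (b \o succn).
  have bT1 y : FS op b y -> T y by move=> /bT [[]].
  have [[Tb nZb] neZ] := bT _ (FS_term b 0).
  (* Taking the tail of the same [b] as reservoir keeps [b 0] + y in [T], so (e + [b 0]) + y = e +
     ([b 0] + y) stays in [B]. *)
  exists (b 0, (Z ++ b 0 :: List.map (op^~ (b 0)) Z)%list, T'); split; last first.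
    split=> //= [b0Z|e eZ beZ]; first exact: nZb b0Z _.
    by apply: (neZ (e, op e (b 0))) => //; apply/List.in_prod_iff.
  have T'T y : T' y -> T y.
    by move=> yT'; apply/bT1/(FS_comp (f := succn) (fun _ _ => id) yT').
  split=> /=.
  - by apply/proper_IP_FS/inj_comp => //; apply: succn_inj.
  - by move=> x /T'T/TB.
  - move=> e /List.in_app_iff [/ZB //|/= [<-|]]; first exact: TB.
    by move=> /List.in_map_iff [e' [<- e'Z]]; apply: ZTB.
  - move=> e eZ y yT'; have bTy := bT1 _ (FS_cons yT').
    move: eZ => /List.in_app_iff [eZ|/= [<-|]]; first exact: ZTB eZ _ (T'T _ yT').
      exact: TB.
    by move=> /List.in_map_iff [e' [<- e'Z]]; rewrite -opA; apply: ZTB.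
have [b [binj bB]] := BI.
have [|q [q0 qIR]] := dependent_choice step (x0 := (b 0, nil, B)).
  by split=> //; exists b.
have [] := @index_meeting_max (fun n => (q n.+1).1.1) (fun n => (q n).1.2).
- by move=> n; have [_ []] := qIR n.
- by move=> n; have [_ []] := qIR n.
- by move=> n; have [_ []] := qIR n.
move=> /disjoint_IPs_meeting zIP zZ.
apply: disjoint_IPs_sub zIP => x /zZ [n].
by have [[_ _ sub _] _] := qIR n; apply: sub.
Qed.

(** * Combining the two cases *)

Lemma large_disjoint_IPs (A : S -> Prop) : large A -> disjoint_IPs A.
Proof.
move=> /disjoint_IPs_or_hereditarily_large [//|[B [/large_proper_IP BI BA hB]]].
apply: (disjoint_IPs_sub BA).
case: (classic (exists C : S -> Prop, [/\ proper_IP op C, forall x, C x -> B x &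
    forall u, C u -> ~ proper_IP op (fun x => C x /\ op u x = u)])).
  move=> [C [CI CB Cu]]; apply: (disjoint_IPs_sub CB).
  apply: disjoint_IPs_of_no_fixed_left => //.
  exact: hereditarily_large_sub CB hB.
move=> noC; apply: disjoint_IPs_of_fixed_left => // C CI CB.
apply: NNPP => nou; apply: noC; exists C; split=> // u Cu uI.
by apply: nou; exists u.
Qed.

End ProperIP.

Theorem theorem5p4 (S : Type) (op : S -> S -> S) (Hassoc : associative_op op)
  (Hpr : forall (k : nat) (c : S -> 'I_k),
           exists A : S -> Prop, proper_IP op A /\ monochromatic c A) :
  forall (k : nat) (c : S -> 'I_k),
    exists A : nat -> (S -> Prop),
      (forall n m, n <> m -> forall x, A n x -> A m x -> False) /\
      (forall n, proper_IP op (A n) /\ monochromatic c (A n)) /\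
      (exists col : 'I_k, forall n x, A n x -> c x = col).
Proof.
move=> k c.
have lS : large op (fun=> True).
  by move=> l d; have [A [AI Am]] := Hpr l d; exists A; split.
(* Working inside one large color class gives all the sets the same color at once. *)
have [col lcol] := large_color c lS.
have [A [Ad AP]] := large_disjoint_IPs Hassoc lcol.
have Acol n x : A n x -> c x = col by have [_ sub] := AP n; case/sub.
exists A; split=> //; split; last by exists col.
by move=> n; have [AI _] := AP n; split=> //; exists col; apply: Acol.
Qed.
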